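(* Let $X,V,H$ be real Hilbert spaces, $A\in\mathcal L(X,V)$, $L\in\mathcal L(X,H)$, and suppose that the conditional stability assumption stated in the context holds for $(A,L)$ with $j$ and $(\eta_{\mathcal C})_{\mathcal C>0}$. Let $u\in X$, $f\in V$ and $\tau\ge 0$ be such that $\|f-Au\|_V\le\tau$, let $X^\delta\subset X$ be a finite dimensional subspace, and for $\varepsilon>0$ with $\varepsilon\|L\|_{\mathcal L(X,H)}\lesssim 1$ let $u_\varepsilon^\delta\in X^\delta$ satisfy $$|||u-u_\varepsilon^\delta|||_\varepsilon\lesssim\tau+\min_{z\in X^\delta}|||u-z|||_\varepsilon+\varepsilon\|Lu\|_H.$$ For $L\neq 0$, let $\varepsilon=\varepsilon(\tau,\delta)>0$ be such that for some $\mathcal C\ge\|Lu\|_H$, $$\tau+\min_{z\in X^\delta}|||u-z|||_\varepsilon\lesssim\varepsilon\,\mathcal C\qquad\text{and}\qquad \varepsilon\|Lu\|_H\lesssim\tau+\min_{z\in X^\delta}\|u-z\|_X.$$ Then $$j(u-u_\varepsilon^\delta)\le\eta_{\mathcal C}\big(\|A(u-u_\varepsilon^\delta)\|_V\big),$$ and $$\|A(u-u_\varepsilon^\delta)\|_V\lesssim\tau+\min_{z\in X^\delta}\|u-z\|_X.$$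
   Context: Notation: $\mathcal L(E,F)$ is the space of bounded linear maps $E\to F$. $C\lesssim D$ means that $C$ can be bounded by a multiple of $D$, independently of parameters on which $C$ and $D$ may depend, such as the discretization index $\delta$ (labelling the subspace $X^\delta$), the tolerance $\tau$, and the regularization parameter $\varepsilon$. Conditional stability assumption: the map $(A,L)\in\mathcal L(X,V\times H)$, $z\mapsto(Az,Lz)$, is injective; and there exist a function $j\colon X\to[0,\infty)$ and, for any $\mathcal C>0$, a non-decreasing function $\eta_{\mathcal C}\colon[0,\infty)\to[0,\infty)$ with $\lim_{t\downarrow0}\eta_{\mathcal C}(t)=0$, such that for every $z\in X$ with $\|Lz\|_H\le\mathcal C$ it holds that $j(z)\le\eta_{\mathcal C}(\|Az\|_V)$. When this is valid with $L=0$ (''unconditional stability''), $\eta_{\mathcal C}\equiv\eta$ is independent of $\mathcal C$, and the bound on $j$ in the claim is to be read with this $\eta$. For $\varepsilon>0$, the norm $|||\cdot|||_\varepsilon$ on $X$ is defined by $|||z|||_\varepsilon:=\sqrt{\|Az\|_V^2+\varepsilon^2\|Lz\|_H^2}$.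
   Formalization: For L ≠ 0 the bound on j is proved with η_{KC}, K ≥ 1 a uniform hidden constant, instead of η_C: the literal bound with the same C fails for general constants in ≲ (e.g. A=L=id on ℝ, j=|z|, η_C(t)=min(t,C), u=C=ε=τ=1, X^δ=ℝ, u_ε^δ=−1). *)

(* Defs.v *)
From HB Require Import structures.
From mathcomp Require Import all_boot all_order all_algebra.
From mathcomp Require Import all_classical all_reals all_analysis.

Set Implicit Arguments.
Unset Strict Implicit.
Unset Printing Implicit Defensive.

Import Order.TTheory GRing.Theory Num.Theory.
Import numFieldNormedType.Exports.

Local Open Scope classical_set_scope.
Local Open Scope ring_scope.

(* Real Hilbert spaces: complete normed modules over the reals whose norm is
   induced by an inner product (a symmetric positive definite bilinear form). *)
HB.mixin Record CompleteNormedModule_isHilbert (R : realType) (V : Type)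
    of CompleteNormedModule R V := {
  hdot : {dot V for @idfun R} ;
  hnormE : forall x : V, `|x| = Num.sqrt (hdot x x)
}.

#[short(type="hilbertType")]
HB.structure Definition Hilbert (R : realType) :=
  {V of CompleteNormedModule_isHilbert R V & CompleteNormedModule R V}.

Definition opnorm (R : realType) (E F : normedModType R) (T : E -> F) : R :=
  sup [set `|T x| | x in [set x : E | `|x| <= 1]].

Definition fin_dim_subspace (R : realType) (E : lmodType R) (W : set E) : Prop :=
  exists (n : nat) (b : 'I_n -> E),
    W = range (fun c : 'I_n -> R => \sum_(i < n) c i *: b i).

(* min_{z in W} N (x - z).  The minimum is written as an infimum: it is attained
   when W is a finite dimensional subspace and N is a norm. *)
Definition min_dist (R : realType) (E : lmodType R) (N : E -> R)
    (W : set E) (x : E) : R :=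
  inf [set N (x - z) | z in W].

Definition tnorm (R : realType) (X V H : normedModType R) (A : X -> V)
    (L : X -> H) (eps : R) (z : X) : R :=
  Num.sqrt (`|A z| ^+ 2 + eps ^+ 2 * `|L z| ^+ 2).

(* The functions eta C are defined on [0, +oo[ and indexed by C > 0, so nothing
   is required of [eta C t] for C <= 0 or t < 0.  The last field is the
   convention for unconditional stability (L = 0), where all the eta C
   coincide. *)
Record conditional_stability (R : realType) (X V H : normedModType R)
    (A : X -> V) (L : X -> H) (j : X -> R) (eta : R -> R -> R) : Prop := {
  stab_inj : injective (fun z : X => (A z, L z)) ;
  stab_j_ge0 : forall z : X, 0 <= j z ;
  stab_eta_ge0 : forall C t : R, 0 < C -> 0 <= t -> 0 <= eta C t ;
  stab_eta_nd : forall C s t : R,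
    0 < C -> 0 <= s -> s <= t -> eta C s <= eta C t ;
  stab_eta_cvg0 : forall C : R, 0 < C -> eta C t @[t --> 0^'+] --> (0 : R) ;
  stab_bound : forall (C : R) (z : X),
    0 < C -> `|L z| <= C -> j z <= eta C `|A z| ;
  stab_uncond : L = cst 0 ->
    forall C C' t : R, 0 < C -> 0 < C' -> 0 <= t -> eta C t = eta C' t
}.

(* Main.v *)
Require Import Defs.
From HB Require Import structures.
From mathcomp Require Import all_boot all_order all_algebra.
From mathcomp Require Import all_classical all_reals all_analysis.
From mathcomp Require Import lra.

(** Write e = u - ued for the error and m for the distance from u to Xd in the
    norm of X.  The square of tnorm eps e is |A e|^2 + eps^2 |L e|^2, so one
    bound on tnorm eps e controls |A e| and eps |L e| at once; the two
    conclusions come from bounding the right-hand side of the quasi-optimality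
    estimate in two different ways.

    - In terms of tau + m: since eps |L| <= K0, the norm tnorm eps is at most
      (|A| + K0) times the norm of X ([tnorm_le]), hence the same holds for the
      two distances to Xd ([min_dist_le]).  Together with the upper bound on
      eps |L u| this gives |A e| <= K (tau + m).
    - In terms of eps C: the lower bound on eps and |L u| <= C give
      eps |L e| <= K1 (K2 + 1) eps C.  Dividing by eps, |L e| <= K C, which
      is what conditional stability needs to bound j e.

    If L = 0, the upper bound on eps |L u| holds because L u = 0, and stability
    applies with every C because L e = 0. *)

Set Implicit Arguments.
Unset Strict Implicit.
Unset Printing Implicit Defensive.

Import Order.TTheory GRing.Theory Num.Theory.
Import numFieldNormedType.Exports.

Local Open Scope classical_set_scope.
Local Open Scope ring_scope.

Lemma opnorm_ub (R : realType) (E F : normedModType R) (T : {linear E -> F})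
    (T_bounded : bounded_fun_norm T) (x : E) : `|x| <= 1 -> `|T x| <= opnorm T.
Proof.
move=> x1; apply: ub_le_sup; last by exists x.
have [M TM] := T_bounded 1.
by exists M => _ [y /= y1 <-]; exact: TM.
Qed.

Lemma opnorm_ge0 (R : realType) (E F : normedModType R) (T : {linear E -> F})
    (T_bounded : bounded_fun_norm T) : 0 <= opnorm T.
Proof.
by have := @opnorm_ub _ _ _ T T_bounded 0; rewrite linear0 !normr0; apply.
Qed.

Lemma le_opnorm (R : realType) (E F : normedModType R) (T : {linear E -> F})
    (T_bounded : bounded_fun_norm T) (x : E) : `|T x| <= opnorm T * `|x|.
Proof.
have [->|x0] := eqVneq x 0; first by rewrite linear0 !normr0 mulr0.
have x_gt0 : 0 < `|x| by rewrite normr_gt0.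
have /(opnorm_ub T_bounded) : `| `|x|^-1 *: x| <= 1.
  by rewrite normrZ ger0_norm ?invr_ge0// mulVf ?gt_eqF.
by rewrite linearZ normrZ ger0_norm ?invr_ge0// mulrC ler_pdivrMr.
Qed.

(** Bounding one norm by a multiple of another carries over to distances from a
    nonempty set; dividing by c > 0 turns this into a lower bound on an
    infimum. *)
Lemma min_dist_le (R : realType) (E : lmodType R) (N N' : E -> R) (c : R)
    (W : set E) (x : E) :
  0 < c -> (forall z, 0 <= N z) -> (forall z, N z <= c * N' z) -> W !=set0 ->
  min_dist N W x <= c * min_dist N' W x.
Proof.
move=> c0 N0 NN' [w Ww]; rewrite mulrC -ler_pdivrMr//.
apply: lb_le_inf; first by exists (N' (x - w)), w.
move=> _ [z Wz <-]; rewrite ler_pdivrMr// mulrC; apply: le_trans (NN' _).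
by apply: ge_inf; [exists 0 => _ [y _ <-]; exact: N0 | exists z].
Qed.

Section tnorm.
Context (R : realType) (X V H : normedModType R).
Implicit Types (A : X -> V) (L : X -> H).

Lemma tnorm_ge0 A L eps z : 0 <= tnorm A L eps z.
Proof. exact: sqrtr_ge0. Qed.

Lemma norm_le_tnorm A L eps z : `|A z| <= tnorm A L eps z.
Proof.
rewrite -[leLHS]ger0_norm// -sqrtr_sqr ler_wsqrtr// lerDl.
by rewrite mulr_ge0 ?sqr_ge0.
Qed.

Lemma reg_le_tnorm A L eps z : 0 <= eps -> eps * `|L z| <= tnorm A L eps z.
Proof.
move=> eps0; rewrite -[leLHS]ger0_norm ?mulr_ge0// -sqrtr_sqr ler_wsqrtr//.
by rewrite exprMn lerDr sqr_ge0.
Qed.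

Lemma tnorm_le_add A L eps z :
  0 <= eps -> tnorm A L eps z <= `|A z| + eps * `|L z|.
Proof.
move=> eps0; have Az := normr_ge0 (A z).
have Lz : 0 <= eps * `|L z| by rewrite mulr_ge0.
rewrite -[leRHS]ger0_norm ?addr_ge0// -sqrtr_sqr ler_wsqrtr// -exprMn sqrrD.
by rewrite lerD2r lerDl mulrn_wge0 ?mulr_ge0.
Qed.

(** This is where the restriction on the size of eps enters: it makes the bound
    uniform in eps. *)
Lemma tnorm_le (A : {linear X -> V}) (L : {linear X -> H}) (K eps : R) (z : X) :
  bounded_fun_norm A -> bounded_fun_norm L -> 0 <= eps -> eps * opnorm L <= K ->
  tnorm A L eps z <= (opnorm A + K) * `|z|.
Proof.
move=> bA bL eps0 epsK; apply: (le_trans (tnorm_le_add _ _ _ eps0)).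
rewrite mulrDl lerD ?le_opnorm//; apply: le_trans (ler_wpM2r _ epsK) => //.
by rewrite -mulrA ler_wpM2l ?le_opnorm.
Qed.

End tnorm.

(* K0, K1, K2, K3 are the constants hidden in the four hypotheses; K is the one
   hidden in the conclusions, uniform in u, f, tau, Xd, eps, ued and C.
   Since the hypotheses only bound the norm of L (u - ued) by a multiple of C,
   the index of eta in the conclusion is K * C, which is again admissible. *)
Theorem theorem2p2 (R : realType) (X V H : hilbertType R)
    (A : {linear X -> V}) (L : {linear X -> H})
    (A_bounded : bounded_fun_norm A) (L_bounded : bounded_fun_norm L)
    (j : X -> R) (eta : R -> R -> R)
    (stab : conditional_stability A L j eta)
    (K0 K1 K2 K3 : R)
    (K0_gt0 : 0 < K0) (K1_gt0 : 0 < K1) (K2_gt0 : 0 < K2) (K3_gt0 : 0 < K3) :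
  exists2 K : R, 1 <= K &
  forall (u : X) (f : V) (tau : R), 0 <= tau -> `|f - A u| <= tau ->
  forall Xd : set X, fin_dim_subspace Xd ->
  forall eps : R, 0 < eps -> eps * opnorm L <= K0 ->
  forall ued : X, Xd ued ->
  tnorm A L eps (u - ued)
    <= K1 * (tau + min_dist (tnorm A L eps) Xd u + eps * `|L u|) ->
  ((L : X -> H) <> cst 0 ->
     forall C : R, 0 < C -> `|L u| <= C ->
     tau + min_dist (tnorm A L eps) Xd u <= K2 * (eps * C) ->
     eps * `|L u| <= K3 * (tau + min_dist (fun z : X => `|z|) Xd u) ->
     j (u - ued) <= eta (K * C) `|A (u - ued)| /\
     `|A (u - ued)| <= K * (tau + min_dist (fun z : X => `|z|) Xd u))
  /\
  ((L : X -> H) = cst 0 ->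
     (forall C : R, 0 < C -> j (u - ued) <= eta C `|A (u - ued)|) /\
     `|A (u - ued)| <= K * (tau + min_dist (fun z : X => `|z|) Xd u)).
Proof.
set a := opnorm A + K0.
have a_gt0 : 0 < a by rewrite ltr_wpDl ?opnorm_ge0.
(* c1 bounds `|A e| against tau + m, and c2 bounds `|L e| against C. *)
pose c1 := K1 * (1 + a + K3); pose c2 := K1 * (K2 + 1).
have c1_gt0 : 0 < c1 by rewrite mulr_gt0//; lra.
have c2_gt0 : 0 < c2 by rewrite mulr_gt0//; lra.
exists (1 + c1 + c2); first by lra.
move=> u f tau tau0 _ Xd _ eps eps0 epsL ued Xued.
set e := u - ued; set m := min_dist (fun z : X => `|z|) Xd u.
set d := min_dist _ Xd u => quasi_opt.
have Xd0 : Xd !=set0 by exists ued.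
have m0 : 0 <= m.
  by apply: lb_le_inf => [|_ [z _ <-]//]; exists `|u - ued|, ued.
have dm : d <= a * m.
  apply: min_dist_le => // z; first exact: tnorm_ge0.
  by apply: tnorm_le => //; exact: ltW.
have Ae := norm_le_tnorm A L eps e.
have Le := reg_le_tnorm A L e (ltW eps0).
(* The case L = 0 satisfies the hypothesis of this bound trivially, so it is
   shared by both cases. *)
have Ae_le : eps * `|L u| <= K3 * (tau + m) ->
    `|A e| <= (1 + c1 + c2) * (tau + m).
  move=> epsLu; have tm0 : 0 <= tau + m by rewrite addr_ge0.
  apply: (@le_trans _ _ (c1 * (tau + m))).
    apply: (le_trans Ae); apply: (le_trans quasi_opt).
    rewrite -mulrA ler_pM2l// mulrDl lerD//.
    have atau : 0 <= a * tau by rewrite mulr_ge0// ltW.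
    by lra.
  by apply: ler_wpM2r => //; lra.
split=> [_ C C0 LuC dC epsLu | L0].
  split; last exact: Ae_le.
  apply: (stab_bound stab).
    by rewrite mulr_gt0//; lra.
  rewrite -(ler_pM2l eps0); apply: (le_trans Le); apply: (le_trans quasi_opt).
  have epsC : 0 <= eps * C by rewrite mulr_ge0// ltW.
  have epsLuC : eps * `|L u| <= eps * C by rewrite ler_pM2l.
  apply: (@le_trans _ _ (c2 * (eps * C))).
    by rewrite -mulrA ler_pM2l// mulrDl mul1r lerD.
  rewrite [leRHS]mulrCA ler_wpM2r//; lra.
have Lz z : `|L z| = 0 by rewrite L0 normr0.
split=> [C C0|]; first by apply: (stab_bound stab) => //; rewrite Lz ltW.
by apply: Ae_le; rewrite Lz mulr0 mulr_ge0 ?addr_ge0// ltW.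
Qed.
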